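(* Let $n\ge 1$ and let $x=(x_1,\dots,x_n)$, $y=(y_1,\dots,y_n)$ be indeterminates. Then, as rational functions: \begin{align*} A(n;x,y;\zeta_4)&=2^{-n^2+n}\prod_{i=1}^n x_i^{-n+1}y_i^{-n+1}\prod_{i,j=1}^n(x_i^2+y_j^2)\cdot \operatorname{perm}\Big(\frac{1}{x_i^2+y_j^2}\Big)_{1\le i,j\le n},\\ A(n;x,y;\zeta_6)&=3^{-n(n-1)/2}\prod_{i=1}^n x_i^{-n+1}y_i^{-n+1}\,\mathrm{GL}_{2n}\big(\delta(n-1,n-1);x_1^2,\dots,x_n^2,y_1^2,\dots,y_n^2\big),\\ A(n;x,y;\zeta_8)&=2^{-n(n-1)/2}\prod_{i=1}^n x_i^{-n+1}y_i^{-n+1}\prod_{1\le i<j\le n}(x_i^2+x_j^2)(y_i^2+y_j^2),\\ A(n;x,x;\zeta_{12})&=\prod_{i=1}^n x_i^{-2n+2}\,\mathrm{GL}_n\big(\delta(p,p-1);x_1^4,\dots,x_n^4\big)\,\mathrm{GL}_n\big(\delta(q,q);x_1^4,\dots,x_n^4\big), \end{align*} where $p=\lfloor n/2\rfloor$ and $q=\lfloor (n-1)/2\rfloor$, and $A(n;x,x;\zeta_{12})$ means $A(n;x,y;\zeta_{12})$ with $y=x$.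
   Context: $\sigma(t)=t-t^{-1}$ and $\zeta_m=\exp(2\pi\sqrt{-1}/m)$. For a parameter $a$ define the $n\times n$ matrix $M(n;x,y;a)_{i,j}=\dfrac{1}{\sigma(ax_i/y_j)\,\sigma(ay_j/x_i)}$, the function $F(n;x,y;a)=\dfrac{\prod_{i,j=1}^n\sigma(ax_i/y_j)\sigma(ay_j/x_i)}{\prod_{1\le i<j\le n}\sigma(x_j/x_i)\sigma(y_i/y_j)}$, and the partition function $A(n;x,y;a)=\sigma(a)^{-n^2+n}F(n;x,y;a)\det M(n;x,y;a)$. $\operatorname{perm}$ is the permanent. Sequences $\delta$: for $r\in\mathbb Z$, $\delta(r)$ is the sequence $(r,r-1,r-2,\dots)$ of all numbers $r-k$ ($k\in\mathbb Z_{\ge0}$) that are $\ge0$ (empty if $r<0$); $\delta(r,s)$ is the sequence obtained by arranging the entries of $\delta(r)$ and $\delta(s)$ together in non-increasing order. When such a sequence is used as the index of a character in $N$ variables, it is replaced by its first $N$ entries, padded with zeros at the end if it has fewer than $N$ entries. For a partition $\lambda=(\lambda_1\ge\dots\ge\lambda_N\ge0)$ and variables $z=(z_1,\dots,z_N)$, $\mathrm{GL}_N(\lambda;z)=\det\big(z_i^{\lambda_j+N-j}\big)_{i,j}/\det\big(z_i^{N-j}\big)_{i,j}$ (the irreducible character of $\mathrm{GL}_N(\mathbb C)$, a symmetric polynomial). *)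

(* Defs.v *)
From HB Require Import structures.
From mathcomp Require Import all_boot all_order all_algebra all_fingroup.
From mathcomp Require Import fraction complex.
From mathcomp Require Import reals trigo.
(* The notations of mpoly clash with those of MathComp-Analysis. *)
From mathcomp Require mpoly.
Import -(notations) mpoly.
Import GRing.Theory.

Set Implicit Arguments.
Unset Strict Implicit.
Unset Printing Implicit Defensive.

Local Open Scope ring_scope.

(* exp (2 pi sqrt(-1) / m), by Euler's formula. *)
Definition zeta (R : realType) (m : nat) : R[i] :=
  Complex (cos (2 * pi / m%:R)) (sin (2 * pi / m%:R)).

(* The field C(x_1, ..., x_n, y_1, ..., y_n) with C = R[i]: the first n of the
   n + n variables are the x_i, the last n are the y_j. *)
Definition ratfun (R : realType) (n : nat) : fieldType :=
  {fraction (mpoly.mpoly (n + n) R[i])}.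

Definition ratC (R : realType) (n : nat) (c : R[i]) : ratfun R n :=
  @FracField.tofrac (mpoly.mpoly (n + n) R[i]) (mpolyC (n + n) c).

Definition xvar (R : realType) (n : nat) (i : 'I_n) : ratfun R n :=
  @FracField.tofrac (mpoly.mpoly (n + n) R[i]) (mpolyX R[i] (mnm1 (lshift n i))).

Definition yvar (R : realType) (n : nat) (j : 'I_n) : ratfun R n :=
  @FracField.tofrac (mpoly.mpoly (n + n) R[i]) (mpolyX R[i] (mnm1 (rshift n j))).

Definition sigma (K : fieldType) (t : K) : K := t - t^-1.

Definition Mmx (K : fieldType) (n : nat) (x y : 'I_n -> K) (a : K) : 'M[K]_n :=
  \matrix_(i, j) (1 / (sigma (a * x i / y j) * sigma (a * y j / x i))).

Definition Ffun (K : fieldType) (n : nat) (x y : 'I_n -> K) (a : K) : K :=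
  (\prod_(i < n) \prod_(j < n) (sigma (a * x i / y j) * sigma (a * y j / x i)))
  / (\prod_(i < n) \prod_(j < n | (i < j)%N)
       (sigma (x j / x i) * sigma (y i / y j))).

Definition Afun (K : fieldType) (n : nat) (x y : 'I_n -> K) (a : K) : K :=
  sigma a ^ (- n%:Z ^+ 2 + n%:Z) * Ffun x y a * \det (Mmx x y a).

Definition permanent (K : fieldType) (n : nat) (B : 'M[K]_n) : K :=
  \sum_(s : 'S_n) \prod_(i < n) B i (s i).

Definition delta1 (r : int) : seq nat :=
  if r is Posz m then rev (iota 0 m.+1) else [::].

Definition delta2 (r s : int) : seq nat := sort geq (delta1 r ++ delta1 s).

(* Columns are indexed from 0, so the exponent lambda_j + N - j of the j-th
   column becomes lambda_j + (N - j.+1).  Reading lambda with [nth 0] for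
   j < N truncates it to N entries or pads it with zeros. *)
Definition GLchar (K : fieldType) (N : nat) (lambda : seq nat) (z : 'I_N -> K)
    : K :=
  \det (\matrix_(i < N, j < N) z i ^+ (nth 0%N lambda j + (N - j.+1)))
  / \det (\matrix_(i < N, j < N) z i ^+ (N - j.+1)).

(* The concatenated family (u_1, ..., u_n, v_1, ..., v_n). *)
Definition catfun (K : Type) (n : nat) (u v : 'I_n -> K) (k : 'I_(n + n)) : K :=
  match split k with inl i => u i | inr j => v j end.

(* Main.v *)
(* With z = x^2 and w = y^2, each entry of M is - z w / Q for the quadratic form
   Q = z^2 + w^2 - (a^2 + a^-2) z w, so that everything reduces to the determinant
   of 1 / Q.  At the four roots of unity Q is (z + w)^2,
   (z^3 - w^3) / (z - w), z^2 + w^2 and (z^3 + w^3) / (z + w).  The first case is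
   Borchardt's identity and the third one is Cauchy's determinant.  The other two
   are instances of Okada's evaluation of det ((b_i - a_j) / (Y_i - X_j)) as the
   determinant with rows (X^k | a X^k) and (Y^k | b Y^k): for X = z^3, a = z this
   is the numerator of a GL_2n character, and for Y = - X, b = - a its columns
   split into even and odd functions of z, which gives a product of two GL_n
   characters.  Comparing with X = z^2, a = z, which gives the denominator, makes
   the sign of the reordering of the columns cancel. *)
Require Import Defs.
From HB Require Import structures.
From mathcomp Require Import all_boot all_order all_algebra all_fingroup.
From mathcomp Require Import fraction complex.
From mathcomp Require Import reals trigo.
From mathcomp Require mpoly.
Import -(notations) mpoly.
From mathcomp Require Import ring lra zify.
Import GRing.Theory.
Local Open Scope ring_scope.

(** * Cauchy's and Okada's determinants *)

Lemma prod_split_diag (K : comRingType) (n : nat) (G : 'I_n -> 'I_n -> K) :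
  \prod_(i < n) \prod_(j < n) G i j =
  (\prod_(i < n) G i i)
  * \prod_(i < n) \prod_(j < n | (i < j)%N) (G i j * G j i).
Proof.
have -> : \prod_(i < n) \prod_(j < n | (i < j)%N) (G i j * G j i) =
    \prod_(i < n) \prod_(j < n | j != i) G i j.
  under eq_bigr => i _ do rewrite big_split /=.
  rewrite big_split /= [X in _ * X](exchange_big_dep predT) //= -big_split /=.
  apply: eq_bigr => i _; rewrite [RHS](bigID (fun j : 'I_n => (i < j)%N)) /=.
  congr (_ * _); apply: eq_bigl => j; rewrite -val_eqE /=; lia.
rewrite -big_split /=; apply: eq_bigr => i _.
by rewrite (bigD1 i).
Qed.

Lemma prod_offdiag (K : comRingType) (n : nat) (G : 'I_n -> 'I_n -> K) :
  \prod_(i < n) \prod_(j < n | j != i) G i j =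
  \prod_(i < n) \prod_(j < n | (i < j)%N) (G i j * G j i).
Proof.
have := prod_split_diag K n (fun i j => if j == i then 1 else G i j).
rewrite [in RHS]big1 ?mul1r => [|i _]; last by rewrite eqxx.
under eq_bigr => i _ do rewrite (bigD1 i) //= eqxx mul1r.
have -> : \prod_(i < n) \prod_(j < n | j != i) (if j == i then 1 else G i j) =
    \prod_(i < n) \prod_(j < n | j != i) G i j.
  by apply: eq_bigr => i _; apply: eq_bigr => j /negPf ->.
move=> ->; apply: eq_bigr => i _; apply: eq_bigr => j ltij.
by rewrite -!val_eqE /= (ltn_eqF ltij) eq_sym (ltn_eqF ltij).
Qed.

Lemma card_pairs (n : nat) :
  (\sum_(i < n) \sum_(j < n | (i < j)%N) 1)%N = (n * (n - 1))./2.
Proof.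
elim: n => [|n IH]; first by rewrite big_ord0.
rewrite big_ord_recl /= big_mkcond big_ord_recl /= add0n sum1_card card_ord.
rewrite (eq_bigr (fun i : 'I_n => \sum_(j < n | (i < j)%N) 1)%N); last first.
  move=> i _; rewrite big_mkcond big_ord_recl /= add0n [RHS]big_mkcond.
  by apply: eq_bigr => j _; rewrite /= /bump !add1n ltnS.
rewrite IH; nia.
Qed.

Lemma prod_pairs_const (K : comRingType) (n : nat) (c : K) :
  \prod_(i < n) \prod_(j < n | (i < j)%N) c = c ^+ (n * (n - 1))./2.
Proof.
rewrite -card_pairs expr_sum; apply: eq_bigr => i _.
by rewrite expr_sum; apply: eq_bigr => j _; rewrite expr1.
Qed.

Lemma prod_pairsM (K : comRingType) (n : nat) (f : 'I_n -> K) :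
  \prod_(i < n) \prod_(j < n | (i < j)%N) (f i * f j) =
  \prod_(i < n) f i ^+ (n - 1).
Proof.
rewrite -(prod_offdiag K n (fun i _ => f i)); apply: eq_bigr => i _.
by rewrite prodr_const cardC1 card_ord subn1.
Qed.

(** The Lagrange basis polynomial of the node [X j], not normalised: its value at [X j] stays as a
    separate factor. *)
Definition lagr (K : fieldType) (n : nat) (X : 'I_n -> K) (j : 'I_n) : {poly K} :=
  \prod_(k < n | k != j) ('X - (X k)%:P).

Lemma size_lagr (K : fieldType) (n : nat) (X : 'I_n -> K) (j : 'I_n) :
  size (lagr K n X j) = n.
Proof.
rewrite size_prod => [|k _]; last by rewrite polyXsubC_eq0.
under eq_bigr => k _ do rewrite size_XsubC.
rewrite sum_nat_const cardC1 card_ord; have := ltn_ord j; lia.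
Qed.

Lemma horner_lagr (K : fieldType) (n : nat) (X : 'I_n -> K) (j : 'I_n) (t : K) :
  (lagr K n X j).[t] = \prod_(k < n | k != j) (t - X k).
Proof. by rewrite horner_prod; apply: eq_bigr => k _; rewrite hornerXsubC. Qed.

Lemma horner_lagr_node (K : fieldType) (n : nat) (X : 'I_n -> K) (i j : 'I_n) :
  i != j -> (lagr K n X j).[X i] = 0.
Proof. by move=> ne; rewrite horner_lagr (bigD1 i) //= subrr mul0r. Qed.

Lemma horner_lagr_neq0 (K : fieldType) (n : nat) (X : 'I_n -> K) (j : 'I_n) :
  injective X -> (lagr K n X j).[X j] != 0.
Proof.
move=> injX; rewrite horner_lagr; apply/prodf_neq0 => k ne.
by rewrite subr_eq0 (inj_eq injX) eq_sym.
Qed.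

(** The difference of [p] and the interpolant has size at most [n] and the [n] distinct roots
    [X j]. *)
Lemma lagr_interp (K : fieldType) (n : nat) (X : 'I_n -> K) (p : {poly K}) (t : K) :
  injective X -> (size p <= n)%N ->
  p.[t] = \sum_(j < n) p.[X j] / (lagr K n X j).[X j] * (lagr K n X j).[t].
Proof.
move=> injX szp.
pose q := \sum_(j < n) (p.[X j] / (lagr K n X j).[X j]) *: lagr K n X j.
have -> : \sum_(j < n) p.[X j] / (lagr K n X j).[X j] * (lagr K n X j).[t] = q.[t].
  by rewrite horner_sum; apply: eq_bigr => j _; rewrite hornerZ.
congr (_.[t]); apply/eqP; rewrite -subr_eq0; apply/eqP.
apply: (@roots_geq_poly_eq0 _ _ (codom X)).
- apply/allP => _ /codomP[i ->]; rewrite rootE hornerD hornerN horner_sum.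
  rewrite (bigD1 i) //= big1 => [|j ne].
    by rewrite hornerZ divfK ?horner_lagr_neq0 // addr0 subrr.
  by rewrite hornerZ (horner_lagr_node K n X i j) ?mulr0 // eq_sym.
- by rewrite map_inj_uniq // enum_uniq.
rewrite size_codom card_ord (leq_trans (size_polyD _ _)) // size_polyN geq_max szp.
apply: (leq_trans (size_sum _ _ _)); apply/bigmax_leqP => j _.
by rewrite (leq_trans (size_scale_leq _ _)) // size_lagr.
Qed.

Definition vand (K : fieldType) (n : nat) (X : 'I_n -> K) : 'M[K]_n :=
  \matrix_(i, k) X i ^+ k.

Lemma det_vand (K : fieldType) (n : nat) (X : 'I_n -> K) :
  \det (vand K n X) = \prod_(i < n) \prod_(j < n | (i < j)%N) (X j - X i).
Proof.
have -> : vand K n X = (Vandermonde n (\row_i X i))^T.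
  by apply/matrixP => i j; rewrite !mxE.
rewrite det_tr det_Vandermonde.
by apply: eq_bigr => i _; apply: eq_bigr => j _; rewrite !mxE.
Qed.

Lemma det_vand_neq0 (K : fieldType) (n : nat) (X : 'I_n -> K) :
  injective X -> \det (vand K n X) != 0.
Proof.
move=> injX; rewrite det_vand; apply/prodf_neq0 => i _; apply/prodf_neq0 => j ltij.
by rewrite subr_eq0 (inj_eq injX) -val_eqE /= gtn_eqF.
Qed.

(** Coefficients go down the columns, so that left multiplication by a Vandermonde matrix evaluates
    the Lagrange polynomials. *)
Definition lagr_mx (K : fieldType) (n : nat) (X : 'I_n -> K) : 'M[K]_n :=
  \matrix_(k, j) (lagr K n X j)`_k.

Lemma vand_lagr (K : fieldType) (n : nat) (X Y : 'I_n -> K) :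
  vand K n Y *m lagr_mx K n X = \matrix_(i, j) (lagr K n X j).[Y i].
Proof.
apply/matrixP => i j; rewrite !mxE (@horner_coef_wide _ n) ?size_lagr //.
by apply: eq_bigr => k _; rewrite !mxE mulrC.
Qed.

Lemma vand_lagr_diag (K : fieldType) (n : nat) (X : 'I_n -> K) :
  vand K n X *m lagr_mx K n X = diag_mx (\row_j (lagr K n X j).[X j]).
Proof.
rewrite vand_lagr; apply/matrixP => i j; rewrite !mxE.
by have [->|ne] := eqVneq; rewrite ?mulr1n // horner_lagr_node.
Qed.

(** Each pair [i < j] contributes [(X i - X j) * (X j - X i)], the opposite of a square. *)
Lemma prod_lagr (K : fieldType) (n : nat) (X : 'I_n -> K) :
  \prod_(j < n) (lagr K n X j).[X j] =
  (-1) ^+ (n * (n - 1))./2 * \det (vand K n X) ^+ 2.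
Proof.
under eq_bigr => j _ do rewrite horner_lagr.
rewrite (prod_offdiag _ _ (fun j k => X j - X k)) det_vand -prod_pairs_const.
rewrite -prodrXl -big_split; apply: eq_bigr => i _ /=.
rewrite -prodrXl -big_split; apply: eq_bigr => j _ /=; ring.
Qed.

Lemma det_lagr_mx (K : fieldType) (n : nat) (X : 'I_n -> K) : injective X ->
  \det (lagr_mx K n X) = (-1) ^+ (n * (n - 1))./2 * \det (vand K n X).
Proof.
move=> injX; apply: (mulfI (det_vand_neq0 _ _ _ injX)).
rewrite -det_mulmx vand_lagr_diag det_diag.
under eq_bigr => j _ do rewrite mxE.
rewrite prod_lagr; ring.
Qed.

Lemma horner_lagr_div (K : fieldType) (n : nat) (X : 'I_n -> K) (j : 'I_n) (t : K) :
  t != X j -> (lagr K n X j).[t] = (\prod_(k < n) (t - X k)) / (t - X j).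
Proof.
rewrite -subr_eq0 => ne; rewrite horner_lagr [in RHS](bigD1 j) //= mulrC mulKf //.
Qed.

(** After row [i] is scaled by the product of all [Y i - X k], the Cauchy matrix consists of the
    values at [Y i] of the Lagrange polynomials of [X], so it factors as [vand Y] times
    [lagr_mx X]. *)
Lemma det_cauchy (K : fieldType) (n : nat) (X Y : 'I_n -> K) :
  injective X -> (forall i j, Y i != X j) ->
  (\prod_(i < n) \prod_(j < n) (Y i - X j))
    * \det (\matrix_(i < n, j < n) (1 / (Y i - X j))) =
  (-1) ^+ (n * (n - 1))./2 * (\det (vand K n X) * \det (vand K n Y)).
Proof.
move=> injX neYX; rewrite [RHS]mulrA -det_lagr_mx // [RHS]mulrC.
rewrite -det_mulmx vand_lagr.
have -> : \matrix_(i < n, j < n) (lagr K n X j).[Y i] =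
    diag_mx (\row_i \prod_(k < n) (Y i - X k))
    *m \matrix_(i < n, j < n) (1 / (Y i - X j)).
  by apply/matrixP => i j; rewrite mul_diag_mx !mxE horner_lagr_div // div1r.
by rewrite det_mulmx det_diag; congr (_ * _); apply: eq_bigr => i _; rewrite mxE.
Qed.

Definition vand2 (K : fieldType) (n : nat) (X Y a b : 'I_n -> K) : 'M[K]_(n + n) :=
  block_mx (vand K n X) (diag_mx (\row_i a i) *m vand K n X)
           (vand K n Y) (diag_mx (\row_i b i) *m vand K n Y).

(** Multiplying both column blocks by [L] turns [vand X] into the diagonal matrix [D]. Subtracting
    the first block times [A] from the second then clears the upper right corner, because [A] and
    [D] commute, and leaves [b i - a j] times a Lagrange value in the lower right one. *)
Lemma det_vand2 (K : fieldType) (n : nat) (X Y a b : 'I_n -> K) :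
  injective X -> (forall i j, Y i != X j) ->
  \det (vand2 K n X Y a b) =
  (-1) ^+ (n * (n - 1))./2 * (\prod_(i < n) \prod_(j < n) (Y i - X j))
  * \det (\matrix_(i < n, j < n) ((b i - a j) / (Y i - X j))).
Proof.
move=> injX neYX; set A := diag_mx (\row_i a i); set B := diag_mx (\row_i b i).
pose L := lagr_mx K n X; pose D := diag_mx (\row_j (lagr K n X j).[X j]).
pose H := vand K n Y *m L.
pose T := \matrix_(i < n, j < n) ((b i - a j) / (Y i - X j)).
have AD : A *m D = D *m A.
  by rewrite !mulmx_diag; congr diag_mx; apply/rowP => i; rewrite !mxE mulrC.
have E : vand2 K n X Y a b *m block_mx L 0 0 L *m block_mx 1%:M (- A) 0 1%:M =
    block_mx D 0 H (diag_mx (\row_i \prod_(k < n) (Y i - X k)) *m T).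
  rewrite /vand2 !mulmx_block !mulmx0 !mulmx1 !addr0 !add0r -!mulmxA.
  rewrite !vand_lagr_diag -/D -/L -/H -/A -/B !mulmxN (mulmxA _ L) (mulmxA _ L) vand_lagr_diag -/D -/H AD addNr; congr block_mx.
  apply/matrixP => i j; rewrite /A /B mul_mx_diag !mul_diag_mx.
  rewrite /H vand_lagr !mxE horner_lagr_div //.
  have := neYX i j; rewrite -subr_eq0 => ne; by field.
move/(congr1 determinant): E; rewrite !det_mulmx det_lblock det_ublock !det1 !mulr1.
rewrite det_lblock det_mulmx !det_diag.
rewrite (eq_bigr (fun j => (lagr K n X j).[X j])) => [|j _]; last by rewrite mxE.
rewrite [in X in _ = _ * (X * _)](eq_bigr (fun i => \prod_(k < n) (Y i - X k)))
  => [|i _]; last by rewrite mxE.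
rewrite prod_lagr /L det_lagr_mx // => E.
have nz := det_vand_neq0 _ _ _ injX.
have nz1 : (-1) ^+ (n * (n - 1))./2 != 0 :> K by rewrite signr_eq0.
(* The cancelled factor is the square of [\det L], one for each column block. *)
apply: (mulIf (mulf_neq0 (mulf_neq0 nz1 nz) (mulf_neq0 nz1 nz))); rewrite E -/T.
rewrite [_ * _ * (_ * _) in RHS]mulrACA -[in RHS](expr2 ((-1) ^+ _)) sqrr_sign mul1r; ring.
Qed.

(** * Borchardt's identity *)

Lemma permanent_expand_row0 (K : fieldType) (n : nat) (B : 'M[K]_n.+1) :
  permanent B = \sum_j B ord0 j * permanent (row' ord0 (col' j B)).
Proof.
rewrite /permanent (partition_big (fun s : 'S_n.+1 => s ord0) predT) //=.
apply: eq_bigr => j0 _.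
rewrite (reindex (lift_perm ord0 j0)) /=; last first.
  (* The inverse of [lift_perm]: [ord0] is deleted from the domain of [s] and its image from the
     codomain. *)
  pose ulsf (s : 'S_n.+1) k := odflt k (unlift (s ord0) (s (lift ord0 k))).
  have ulsfK (s : 'S_n.+1) k : lift (s ord0) (ulsf s k) = s (lift ord0 k).
    rewrite /ulsf; have := neq_lift ord0 k.
    by rewrite -(inj_eq (@perm_inj _ s)) => /unlift_some[] ? ? ->.
  have inj_ulsf (s : 'S_n.+1) : injective (ulsf s).
    move=> k l /(congr1 (lift (s ord0))); rewrite !ulsfK.
    by move=> /perm_inj/lift_inj.
  exists (fun s => perm (inj_ulsf s)) => [s _ | s].
    by apply/permP => k; rewrite permE /ulsf lift_perm_lift lift_perm_id liftK.
  move/eqP=> si0; apply/permP => k.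
  case: (unliftP ord0 k) => [k'|] ->; rewrite ?lift_perm_id //.
  by rewrite lift_perm_lift -si0 permE ulsfK.
rewrite big_distrr /=; apply: eq_big => [s | s _]; first by rewrite lift_perm_id eqxx.
rewrite big_ord_recl lift_perm_id; congr (_ * _).
by apply: eq_bigr => k _; rewrite !mxE lift_perm_lift.
Qed.

Lemma permanent0 (K : fieldType) (B : 'M[K]_0) : permanent B = 1.
Proof.
rewrite /permanent (big_pred1 1%g) ?big_ord0 // => s.
by rewrite /= -[RHS]/(s == 1%g); apply/esym/eqP/permP => -[].
Qed.

Section Borchardt.
Variables (K : fieldType) (n : nat) (x y : 'I_n.+1 -> K).
Hypotheses (injx : injective x) (injy : injective y) (nexy : forall i j, x i != y j).

Let C : 'M[K]_n.+1 := \matrix_(i, j) (x i - y j)^-1.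
Let C2 : 'M[K]_n.+1 := \matrix_(i, j) (x i - y j)^-1 ^+ 2.

(** The residue at [x i] of the rational function of t with zeros at the [y k] and poles at the
    [x k]. *)
Let r (i : 'I_n.+1) := (\prod_k (x i - y k)) / (lagr K _ x i).[x i].
Let u (j : 'I_n.+1) := r ord0 * (lagr K _ x ord0).[y j] / (lagr K _ y j).[y j].

Let sub_neq0 i j : x i - y j != 0. Proof. by rewrite subr_eq0. Qed.
Let sub_neq0' i j : y j - x i != 0. Proof. by rewrite subr_eq0 eq_sym. Qed.

Let r0_neq0 : r ord0 != 0.
Proof.
rewrite mulf_neq0 ?invr_eq0 ?horner_lagr_neq0 //.
by apply/prodf_neq0 => k _.
Qed.

Let u_neq0 j : u j != 0.
Proof.
have A_neq0 : (lagr K _ x ord0).[y j] != 0.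
  by rewrite horner_lagr; apply/prodf_neq0 => k _.
apply: mulf_neq0; first exact: mulf_neq0.
by rewrite invr_eq0 horner_lagr_neq0.
Qed.

(* Lagrange interpolation at the nodes [y] shows that [u] solves
   [C u = e_0], so that it is the first column of the inverse of [C]. *)
Lemma cauchy_cofactor j : cofactor C ord0 j = \det C * u j.
Proof.
have Cu : C *m (\col_j u j) = delta_mx ord0 ord0.
  apply/matrixP => i k; rewrite !mxE [k]ord1 eqxx andbT.
  have Phi_neq0 : \prod_k (x i - y k) != 0 by apply/prodf_neq0 => l _.
  (* This is interpolation of [lagr x ord0] at the nodes [y], evaluated at [x i]; the value vanishes
     unless [i] is [ord0]. *)
  have -> : \sum_j C i j * (\col_j u j) j ord0 =
      r ord0 * ((lagr K _ x ord0).[x i] / \prod_k (x i - y k)).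
    rewrite (lagr_interp K _ y (lagr K _ x ord0) (x i) injy) ?size_lagr //.
    rewrite big_distrl big_distrr /=; apply: eq_bigr => l _.
    rewrite !mxE /u (horner_lagr_div _ _ y l (x i)) //; have := sub_neq0 i l => ne.
    have ne' := horner_lagr_neq0 K _ y l injy.
    by field; rewrite ne ne' Phi_neq0.
  have [ei|ne] := eqVneq; last by rewrite horner_lagr_node // mul0r mulr0.
  have ne := horner_lagr_neq0 K _ x ord0 injx.
  by rewrite /r; rewrite ei in Phi_neq0 *; rewrite mulrA divfK // divff.
have := congr1 (mulmx (\adj C)) Cu; rewrite mulmxA mul_adj_mx mul_scalar_mx.
move/matrixP/(_ j ord0); rewrite !mxE => ->.
rewrite (bigD1 ord0) //= big1 => [|i /negPf ne]; last by rewrite !mxE ne mulr0.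
by rewrite !mxE !eqxx mulr1 addr0.
Qed.

(** Interpolate the Lagrange polynomial of [y j] at the nodes [x] and evaluate at [y j]: each of the
    two Lagrange values in a term brings a factor [(x i - y j)^-1] up to sign, whence the squares.
    The coefficients [r i / r ord0] do not depend on [j]. *)
Lemma cauchy_sqr_combination j :
  (x ord0 - y j)^-1 / u j = \sum_i r i / r ord0 * C2 i j.
Proof.
pose Psi := \prod_k (y j - x k).
have Psi_neq0 : Psi != 0 by apply/prodf_neq0 => l _.
have neB := horner_lagr_neq0 K _ y j injy.
have B_sum : (lagr K _ y j).[y j] = - Psi * \sum_i r i * C2 i j.
  rewrite [LHS](lagr_interp K _ x _ _ injx) ?size_lagr // big_distrr /=.
  apply: eq_bigr => i _; rewrite !mxE (horner_lagr_div _ _ y j (x i)) //.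
  rewrite (horner_lagr_div _ _ x i (y j)) 1?eq_sym // -/Psi /r.
  have ne := horner_lagr_neq0 K _ x i injx.
  have ne1 := sub_neq0 i j; have ne2 := sub_neq0' i j.
  by field; rewrite ne ne1 ne2.
have -> : \sum_i r i / r ord0 * C2 i j = (lagr K _ y j).[y j] / (- Psi * r ord0).
  rewrite B_sum -mulf_div divff ?oppr_eq0 // mul1r big_distrl /=.
  by apply: eq_bigr => i _; rewrite mulrAC.
rewrite /u (horner_lagr_div _ _ x ord0 (y j)) 1?eq_sym // -/Psi.
have ne1 := sub_neq0 ord0 j; have ne2 := sub_neq0' ord0 j; have ne0 := r0_neq0.
by field; rewrite oppr_eq0 ne1 ne2 ne0 neB Psi_neq0.
Qed.

(** Adding multiples of the other rows of [C2] to row [ord0] keeps its determinant and turns that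
    row into [C ord0 j / u j]. Expanding along it, the hypothesis splits each minor into a
    determinant and a permanent; the determinant divided by [u j] is [\det C] up to the cofactor
    sign, and what is left is the expansion of the permanent. *)
Lemma borchardt_step :
  (forall j, \det (row' ord0 (col' j C)) * permanent (row' ord0 (col' j C)) =
             \det (row' ord0 (col' j C2))) ->
  \det C * permanent C = \det C2.
Proof.
move=> IH; rewrite permanent_expand_row0 big_distrr /=.
have -> : \det C2 = \sum_i r i / r ord0 * (C2 *m \adj C2) i ord0.
  rewrite mul_mx_adj (bigD1 ord0) //= big1 => [|i /negPf ne].
    by rewrite mxE eqxx divff // mul1r addr0.
  by rewrite mxE ne mulr0.
under [RHS]eq_bigr => i _ do rewrite mxE big_distrr /=.
rewrite exchange_big /=; apply: eq_bigr => j _.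
under eq_bigr => i _ do rewrite mulrA.
rewrite -big_distrl /= -cauchy_sqr_combination [(\adj C2) j ord0]mxE {1}/cofactor -IH.
(* [\det C] is expressed through the cofactor of the current column [j], so that both sides carry
   the same minor. *)
have -> : \det C = cofactor C ord0 j / u j by rewrite cauchy_cofactor mulfK.
by rewrite mxE /cofactor; field; rewrite u_neq0 sub_neq0.
Qed.
End Borchardt.

Lemma borchardt (K : fieldType) (n : nat) (x y : 'I_n -> K) :
  injective x -> injective y -> (forall i j, x i != y j) ->
  \det (\matrix_(i, j) (x i - y j)^-1)
    * permanent (\matrix_(i < n, j < n) (x i - y j)^-1) =
  \det (\matrix_(i, j) (x i - y j)^-1 ^+ 2).
Proof.
elim: n => [|n IH] in x y *; first by rewrite !det_mx00 permanent0 mulr1.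
move=> injx injy ne; apply: borchardt_step => // j.
have minorE (F : K -> K) :
    row' ord0 (col' j (\matrix_(i < n.+1, k < n.+1) F (x i - y k))) =
    \matrix_(i, k) F (x (lift ord0 i) - y (lift j k)).
  by apply/matrixP => i k; rewrite !mxE.
rewrite (minorE (fun t => t^-1)) (minorE (fun t => t^-1 ^+ 2)).
apply: (IH (x \o lift ord0) (y \o lift j)) => // i k /=.
- by move=> /injx/lift_inj.
- by move=> /injy/lift_inj.
exact: ne.
Qed.

(** * The partition function in terms of a quadratic form *)

(** The form Q at z = [u ^+ 2] and w = [v ^+ 2]. *)
Definition quad {K : fieldType} (a u v : K) : K :=
  u ^+ 4 + v ^+ 4 - (a ^+ 2 + a ^- 2) * u ^+ 2 * v ^+ 2.

Lemma sigma_mul (K : fieldType) (a u v : K) : a != 0 -> u != 0 -> v != 0 ->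
  sigma (a * u / v) * sigma (a * v / u) = - quad a u v / (u ^+ 2 * v ^+ 2).
Proof. by move=> a0 u0 v0; rewrite /sigma /quad; field; rewrite a0 u0 v0. Qed.

Lemma sigma_divM (K : fieldType) (u u' v v' : K) :
  u != 0 -> u' != 0 -> v != 0 -> v' != 0 ->
  sigma (u' / u) * sigma (v / v') =
  - 1 * ((u' ^+ 2 - u ^+ 2) * (v' ^+ 2 - v ^+ 2)) / ((u * u') * (v * v')).
Proof. by move=> u0 u0' v0 v0'; rewrite /sigma; field; rewrite u0 u0' v0 v0'. Qed.

Lemma prod_expz_opp (K : fieldType) (n : nat) (f : 'I_n.+1 -> K) :
  \prod_(i < n.+1) f i ^ (- n.+1%:Z + 1) = (\prod_(i < n.+1) f i) ^- n.
Proof.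
rewrite -exprVn -prodfV -prodrXl; apply: eq_bigr => i _.
have -> : - n.+1%:Z + 1 = - n%:Z by lia.
by rewrite -exprnN exprVn.
Qed.

(** The product of the [x i] gets exponent -2n from the numerator of [Ffun], n - 1 from its
    denominator and 2 from [\det (Mmx x y a)], in total -n + 1, and likewise for [y]. The signs
    indexed by n^2 and n cancel; the one of the pairs [i < j] joins the power of [sigma a]. *)
Lemma Afun_quad (K : fieldType) (n : nat) (x y : 'I_n -> K) (a : K) :
  (0 < n)%N -> a != 0 -> (forall i, x i != 0) -> (forall i, y i != 0) ->
  Afun x y a =
  (- sigma a ^+ 2) ^- (n * (n - 1))./2
  * (\prod_(i < n) (x i ^ (- n%:Z + 1) * y i ^ (- n%:Z + 1)))
  * ((\prod_(i < n) \prod_(j < n) quad a (x i) (y j))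
     * \det (\matrix_(i < n, j < n) (quad a (x i) (y j))^-1)
     / (\prod_(i < n) \prod_(j < n | (i < j)%N)
          ((x j ^+ 2 - x i ^+ 2) * (y j ^+ 2 - y i ^+ 2)))).
Proof.
case: n x y => // m x y _ a0 x0 y0; set n := m.+1; rewrite /Afun /Ffun.
have -> : sigma a ^ (- n%:Z ^+ 2 + n%:Z) = (sigma a ^+ 2) ^- (n * (n - 1))./2.
  rewrite -exprM exprnN; congr (_ ^ _).
  have /= := odd_double_half (n * (n - 1)); rewrite oddM subn1 /= andNb add0n -mul2n.
  by rewrite /n /= => E; rewrite expr2 -PoszM; lia.
have -> : \prod_(i < n) \prod_(j < n)
     (sigma (a * x i / y j) * sigma (a * y j / x i)) =
  (-1) ^+ (n * n) * (\prod_(i < n) \prod_(j < n) quad a (x i) (y j))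
   / ((\prod_(i < n) x i) ^+ (2 * n) * (\prod_(i < n) y i) ^+ (2 * n)).
  transitivity (\prod_(i < n) \prod_(j < n)
    (- 1 * quad a (x i) (y j) / (x i ^+ 2 * y j ^+ 2))).
    apply: eq_bigr => i _; apply: eq_bigr => j _.
    by rewrite sigma_mul // mulN1r.
  under eq_bigr => i _ do rewrite prodf_div big_split [X in _ / X]big_split /=.
  rewrite prodf_div big_split [X in _ / X]big_split /= !prodr_const card_ord.
  rewrite -!exprM; under [X in _ / (X * _)]eq_bigr => i _ do rewrite prodr_const card_ord -exprM.
  by rewrite !prodrXl -exprM.
have -> : \prod_(i < n) \prod_(j < n | (i < j)%N)
     (sigma (x j / x i) * sigma (y i / y j)) =
  (-1) ^+ (n * (n - 1))./2 * (\prod_(i < n) \prod_(j < n | (i < j)%N)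
          ((x j ^+ 2 - x i ^+ 2) * (y j ^+ 2 - y i ^+ 2)))
   / ((\prod_(i < n) x i) ^+ m * (\prod_(i < n) y i) ^+ m).
  transitivity (\prod_(i < n) \prod_(j < n | (i < j)%N)
    (- 1 * ((x j ^+ 2 - x i ^+ 2) * (y j ^+ 2 - y i ^+ 2))
       / ((x i * x j) * (y i * y j)))).
    by apply: eq_bigr => i _; apply: eq_bigr => j _; rewrite sigma_divM.
  under eq_bigr => i _ do rewrite prodf_div big_split [X in _ / X]big_split /=.
  rewrite prodf_div big_split [X in _ / X]big_split /=.
  by rewrite prod_pairs_const !prod_pairsM subn1 !prodrXl.
have -> : \det (Mmx x y a) =
  (-1) ^+ n * (\prod_(i < n) x i) ^+ 2 * (\prod_(i < n) y i) ^+ 2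
  * \det (\matrix_(i < n, j < n) (quad a (x i) (y j))^-1).
  have -> : Mmx x y a = diag_mx (\row_i (- 1 * x i ^+ 2)) *m
      (\matrix_(i < n, j < n) (quad a (x i) (y j))^-1 *m diag_mx (\row_j y j ^+ 2)).
    apply/matrixP => i j; rewrite mul_mx_diag mul_diag_mx !mxE sigma_mul //.
    by rewrite div1r invf_div invrN; ring.
  rewrite !det_mulmx !det_diag.
  rewrite (eq_bigr (fun i => - 1 * x i ^+ 2)) => [|i _]; last by rewrite mxE.
  rewrite [X in _ * (_ * X) = _](eq_bigr (fun i => y i ^+ 2))
    => [|i _]; last by rewrite mxE.
  by rewrite big_split /= prodr_const card_ord !prodrXl; ring.
rewrite big_split /= !prod_expz_opp.
have : \prod_(i < n) x i != 0 by apply/prodf_neq0 => i _.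
have : \prod_(i < n) y i != 0 by apply/prodf_neq0 => i _.
move: (\prod_(i < n) x i) (\prod_(i < n) y i) => X Y Y0 X0.
have X1 : X ^+ m != 0 by rewrite expf_neq0.
have Y1 : Y ^+ m != 0 by rewrite expf_neq0.
set V := \prod_(i < n) \prod_(j < n | (i < j)%N) _.
have -> : (-1) ^+ (n * n) = (-1) ^+ n :> K.
  by rewrite -signr_odd oddM andbb signr_odd.
have nn : (-1) ^+ n * (-1) ^+ n = 1 :> K by rewrite -expr2 sqrr_sign.
have -> : (2 * n = m + m + 2)%N by lia.
rewrite (exprNn (sigma a ^+ 2)) !exprD !invfM !invrK; move: nn.
move: ((-1) ^+ n) ((-1) ^- _) (_ ^- (n * (n - 1))./2) (V^-1) (\prod_(i < n) _) (\det _).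
move=> s e c V' Q D nn; rewrite -[RHS]mul1r -nn; move: (X ^+ m) (Y ^+ m) X1 Y1 => Xm Ym X1 Y1.
by field; rewrite X0 Y0 X1 Y1.
Qed.

Lemma vand_ratio (K : fieldType) (n : nat) (z w : 'I_n -> K) :
  \prod_(i < n) \prod_(j < n | (i < j)%N) ((z j - z i) * (w j - w i)) =
  \det (vand K n z) * \det (vand K n w).
Proof.
by rewrite !det_vand -big_split; apply: eq_bigr => i _; rewrite -big_split.
Qed.

Lemma det_vand_opp (K : fieldType) (n : nat) (z : 'I_n -> K) :
  \det (vand K n (fun i => - z i)) =
  (-1) ^+ (n * (n - 1))./2 * \det (vand K n z).
Proof.
rewrite !det_vand -prod_pairs_const -big_split; apply: eq_bigr => i _ /=.
rewrite -big_split; apply: eq_bigr => j _ /=; ring.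
Qed.

(** Cauchy's determinant at the nodes [- w]: its sign cancels that of the Vandermonde determinant of
    [- w]. *)
Lemma det_cauchy_add (K : fieldType) (n : nat) (z w : 'I_n -> K) :
  injective w -> (forall i j, z i + w j != 0) ->
  (\prod_(i < n) \prod_(j < n) (z i + w j))
    * \det (\matrix_(i < n, j < n) (z i + w j)^-1) =
  \det (vand K n z) * \det (vand K n w).
Proof.
move=> injw ne; have inj' : injective (fun i => - w i) by move=> i j /oppr_inj/injw.
have := det_cauchy K n _ z inj'; rewrite det_vand_opp [X in _ = _ * X]mulrAC.
rewrite 2!mulrA -expr2 sqrr_sign mul1r mulrC => <- => [|i j]; last first.
  by rewrite -subr_eq0 opprK.
rewrite [RHS]mulrC; congr (_ * _).
  by apply: eq_bigr => i _; apply: eq_bigr => j _; rewrite opprK.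
by congr determinant; apply/matrixP => i j; rewrite !mxE opprK div1r.
Qed.

(** Cauchy's determinant for the squares yields Vandermonde determinants of squares; divided by
    those of [z] and [w], each pair leaves a sum. *)
Lemma cauchy_squares (K : fieldType) (n : nat) (z w : 'I_n -> K) :
  injective (fun i => z i ^+ 2) -> injective (fun i => w i ^+ 2) ->
  (forall i j, z i ^+ 2 + w j ^+ 2 != 0) ->
  (\prod_(i < n) \prod_(j < n) (z i ^+ 2 + w j ^+ 2))
  * \det (\matrix_(i < n, j < n) (z i ^+ 2 + w j ^+ 2)^-1)
  / (\prod_(i < n) \prod_(j < n | (i < j)%N) ((z j - z i) * (w j - w i))) =
  \prod_(i < n) \prod_(j < n | (i < j)%N) ((z i + z j) * (w i + w j)).
Proof.
move=> injz injw ne; rewrite (det_cauchy_add _ _ (fun i => z i ^+ 2)) // -vand_ratio.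
rewrite -prodf_div; apply: eq_bigr => i _; rewrite -prodf_div; apply: eq_bigr => j ltij.
have sub_neq0 (t : 'I_n -> K) : injective (fun i => t i ^+ 2) -> t j - t i != 0.
  move=> injt; rewrite subr_eq0; apply: contraTneq ltij => e.
  by rewrite (injt i j) ?ltnn //= e.
by field; rewrite !sub_neq0.
Qed.

(** Borchardt's identity at [z] and [- w] splits off the Cauchy determinant, which together with one
    of the two products of the [z i + w j] cancels the Vandermonde determinants. *)
Lemma borchardt_squares (K : fieldType) (n : nat) (z w : 'I_n -> K) :
  injective z -> injective w -> (forall i j, z i + w j != 0) ->
  (\prod_(i < n) \prod_(j < n) (z i + w j) ^+ 2)
  * \det (\matrix_(i < n, j < n) ((z i + w j) ^+ 2)^-1)
  / (\prod_(i < n) \prod_(j < n | (i < j)%N) ((z j - z i) * (w j - w i))) =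
  (\prod_(i < n) \prod_(j < n) (z i + w j))
  * permanent (\matrix_(i < n, j < n) (z i + w j)^-1).
Proof.
move=> injz injw ne; have inj' : injective (fun i => - w i) by move=> i j /oppr_inj/injw.
have ne' i j : z i != - w j by rewrite -subr_eq0 opprK.
have := borchardt K n z _ injz inj' ne'.
have -> : \matrix_(i < n, j < n) (z i - - w j)^-1 = \matrix_(i < n, j < n) (z i + w j)^-1.
  by apply/matrixP => i j; rewrite !mxE opprK.
have -> : \matrix_(i < n, j < n) (z i - - w j)^-1 ^+ 2 =
    \matrix_(i < n, j < n) ((z i + w j) ^+ 2)^-1.
  by apply/matrixP => i j; rewrite !mxE opprK exprVn.
move=> <-; under eq_bigr => i _ do rewrite prodrXl.
rewrite prodrXl vand_ratio -det_cauchy_add //.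
have nz : \det (vand K n z) * \det (vand K n w) != 0.
  by rewrite mulf_neq0 // det_vand_neq0.
move: nz; rewrite -det_cauchy_add // mulf_eq0 negb_or => /andP[nz1 nz2].
by field; rewrite nz1 nz2.
Qed.

(** * Characters of the general linear group *)

Lemma catfunl (K : Type) (n : nat) (u v : 'I_n -> K) (k : 'I_n) :
  catfun u v (lshift n k) = u k.
Proof. by rewrite /catfun -[lshift n k]/(unsplit (inl k)) unsplitK. Qed.

Lemma catfunr (K : Type) (n : nat) (u v : 'I_n -> K) (k : 'I_n) :
  catfun u v (rshift n k) = v k.
Proof. by rewrite /catfun -[rshift n k]/(unsplit (inr k)) unsplitK. Qed.

Lemma shuffle_subproof (n : nat) (k : 'I_n) (b : bool) :
  (n + n - (2 * k + b).+1 < n + n)%N.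
Proof. by have := ltn_ord k; lia. Qed.

(* Matches the columns of [vand2], where column [k] of the first block stands for
   the degree [2 k] and column [k] of the second one for the degree [2 k + 1],
   with columns listed by decreasing degree, as in [GLchar]. *)
Definition shuffle_fun (n : nat) (k : 'I_(n + n)) : 'I_(n + n) :=
  match split k with
  | inl k => Ordinal (shuffle_subproof n k false)
  | inr k => Ordinal (shuffle_subproof n k true)
  end.

Lemma shuffle_lshift (n : nat) (k : 'I_n) :
  shuffle_fun n (lshift n k) = Ordinal (shuffle_subproof n k false).
Proof. by rewrite /shuffle_fun -[lshift n k]/(unsplit (inl k)) unsplitK. Qed.

Lemma shuffle_rshift (n : nat) (k : 'I_n) :
  shuffle_fun n (rshift n k) = Ordinal (shuffle_subproof n k true).
Proof. by rewrite /shuffle_fun -[rshift n k]/(unsplit (inr k)) unsplitK. Qed.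

Lemma shuffle_inj (n : nat) : injective (shuffle_fun n).
Proof.
move=> i j; case: (split_ordP i) => k ->; case: (split_ordP j) => l ->;
  rewrite ?shuffle_lshift ?shuffle_rshift => /(congr1 val) /= e.
- by congr lshift; apply: val_inj => /=; have := ltn_ord k; have := ltn_ord l; lia.
- by have := ltn_ord k; have := ltn_ord l; lia.
- by have := ltn_ord k; have := ltn_ord l; lia.
by congr rshift; apply: val_inj => /=; have := ltn_ord k; have := ltn_ord l; lia.
Qed.

Definition shuffle (n : nat) : 'S_(n + n) := perm (shuffle_inj n).

(** Used with [d = 2] for the denominator of a character, whose exponents are 2k + b, and with
    [d = 3] for the numerator, where the part k added to the exponent 2k + b gives 3k + b. *)
Lemma det_vand2_shuffle (K : fieldType) (n d : nat) (z w : 'I_n -> K) (e : nat -> nat) :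
  (forall (k : nat) (b : bool), (k < n)%N ->
     e (n + n - (2 * k + b).+1)%N = (d * k + b)%N) ->
  (-1) ^+ shuffle n * \det (\matrix_(i < n + n, j < n + n) catfun z w i ^+ e j) =
  \det (vand2 K n (fun i => z i ^+ d) (fun i => w i ^+ d) z w).
Proof.
move=> he; have he0 k := he k false; have he1 k := he k true; rewrite /= in he0 he1.
set A := \matrix_(i, j) _.
(* [col_permE] involves the inverse permutation, which has the same sign. *)
rewrite -(odd_permV (shuffle n)) -det_perm mulrC -det_mulmx -col_permE.
congr determinant; apply/matrixP => i j; rewrite mxE mxE permE /vand2 !mul_diag_mx.
case: (split_ordP i) => k ->; case: (split_ordP j) => l ->;
  rewrite ?shuffle_lshift ?shuffle_rshift ?catfunl ?catfunr
    ?block_mxEul ?block_mxEur ?block_mxEdl ?block_mxEdr !mxE /= ?he0 ?he1 ?ltn_ord //.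
- by rewrite addn0 exprM.
- by rewrite exprD expr1 exprM mulrC.
- by rewrite addn0 exprM.
- by rewrite exprD expr1 exprM mulrC.
Qed.

Lemma sorted_mkseq_geq (f : nat -> nat) (N : nat) :
  {homo f : i j / (i <= j)%N >-> (j <= i)%N} -> sorted geq (mkseq f N).
Proof.
by move=> hf; apply: (homo_sorted hf); exact: iota_sorted.
Qed.

Lemma sort_geq_unique (s t : seq nat) : sorted geq t -> perm_eq s t -> sort geq s = t.
Proof.
move=> st pst; apply: (@sorted_eq _ geq) => //.
- by move=> a b c /= ab bc; apply: leq_trans bc ab.
- by move=> a b /andP[ab ba]; apply/eqP; rewrite eqn_leq; apply/andP; split.
- by apply: sort_sorted => a b; exact: leq_total.
by rewrite perm_sort.
Qed.

Lemma mkseqD (T : Type) (f : nat -> T) (k N : nat) :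
  mkseq f (k + N) = mkseq f k ++ mkseq (fun j => f (k + j)%N) N.
Proof.
by rewrite /mkseq iotaD map_cat add0n -[in iota k N](addn0 k) iotaDl -map_comp.
Qed.

Lemma delta1S (m : nat) : delta1 m.+1 = m.+1 :: delta1 m.
Proof. by rewrite /delta1 -[m.+2]addn1 iotaD rev_cat. Qed.

Lemma delta1_double (m : nat) :
  perm_eq (delta1 m ++ delta1 m) (mkseq (fun j => m - j./2)%N (2 * m.+1)).
Proof.
elim: m => // m IH; rewrite delta1S.
have -> : mkseq (fun j => m.+1 - j./2)%N (2 * m.+2) =
    [:: m.+1, m.+1 & mkseq (fun j => m - j./2)%N (2 * m.+1)].
  by rewrite mulnS mkseqD; congr (_ ++ _); apply: eq_map => j; lia.
rewrite cat_cons perm_cons; apply: perm_trans (_ : perm_eq _ (m.+1 :: (delta1 m ++ delta1 m))) _.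
  by rewrite perm_catC cat_cons perm_cons.
by rewrite perm_cons.
Qed.

Lemma delta2_double (m : nat) :
  delta2 m m = mkseq (fun j => m - j./2)%N (2 * m.+1).
Proof.
apply: sort_geq_unique (delta1_double m).
by apply: sorted_mkseq_geq => i j; lia.
Qed.

Lemma delta2_pred (p : nat) :
  delta2 p (p%:Z - 1) = mkseq (fun j => p - uphalf j)%N (2 * p).+1.
Proof.
apply: sort_geq_unique; first by apply: sorted_mkseq_geq => i j; lia.
(* For [p = 0] the second index is -1 and its sequence is empty. Otherwise, behind the leading
   [p.+1] comes the doubled sequence of [p]. *)
case: p => [//|p]; have -> : p.+1%:Z - 1 = p%:Z by lia.
rewrite delta1S -[(2 * p.+1).+1]add1n mkseqD cat1s perm_cons.
have -> : mkseq (fun j => p.+1 - uphalf (1 + j))%N (2 * p.+1) =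
    mkseq (fun j => p - j./2)%N (2 * p.+1).
  by apply: eq_map => j; lia.
exact: delta1_double.
Qed.

Lemma prod2M (K : comRingType) (n : nat) (F G : 'I_n -> 'I_n -> K) :
  \prod_(i < n) \prod_(j < n) (F i j * G i j) =
  (\prod_(i < n) \prod_(j < n) F i j) * \prod_(i < n) \prod_(j < n) G i j.
Proof. by rewrite -big_split; apply: eq_bigr => i _; rewrite big_split. Qed.

Lemma inj_exp (K : fieldType) (n d : nat) (z : 'I_n -> K) :
  injective (fun i => z i ^+ d) -> injective z.
Proof. by move=> injz i j e; apply: injz; rewrite e. Qed.

(** Both determinants of the character are [vand2] up to the same sign [s]. In Okada's evaluation
    the factors [w i - z j] cancel, leaving the quadratic form in the numerator and the Cauchy
    matrix of [z i + w j] in the denominator; the latter gives the two Vandermonde determinants. *)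
Lemma GLchar_double (K : fieldType) (n : nat) (z w : 'I_n -> K) :
  (0 < n)%N ->
  injective (fun i => z i ^+ 2) -> injective (fun i => z i ^+ 3) -> injective w ->
  (forall i j, w i ^+ 2 != z j ^+ 2) -> (forall i j, w i ^+ 3 != z j ^+ 3) ->
  (\prod_(i < n) \prod_(j < n) (z i ^+ 2 + z i * w j + w j ^+ 2))
  * \det (\matrix_(i < n, j < n) (z i ^+ 2 + z i * w j + w j ^+ 2)^-1)
  / (\prod_(i < n) \prod_(j < n | (i < j)%N) ((z j - z i) * (w j - w i))) =
  GLchar (delta2 (n%:Z - 1) (n%:Z - 1)) (catfun z w).
Proof.
move=> n0 inj2 inj3 injw ne2 ne3.
have injz : injective z := inj_exp _ _ _ _ inj2.
have neB i j : w i - z j != 0.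
  by have := ne2 i j; rewrite -subr_eq0 subr_sqr mulf_eq0 negb_or => /andP[].
have neD i j : w i + z j != 0.
  by have := ne2 i j; rewrite -subr_eq0 subr_sqr mulf_eq0 negb_or => /andP[].
have -> : n%:Z - 1 = (n - 1)%N%:Z by lia.
rewrite delta2_double /GLchar.
have := signr_eq0 K (shuffle n); set s := (-1) ^+ _ => s0.
rewrite -[RHS]mul1r -[X in _ = X * _](@divff _ s) ?s0 // [RHS]mulf_div.
rewrite (det_vand2_shuffle K n 3 z w
  (fun j => nth 0 (mkseq (fun j => n - 1 - j./2) (2 * (n - 1).+1)) j + (n + n - j.+1))%N);
  last by move=> k b ltk; rewrite nth_mkseq; lia.
rewrite (det_vand2_shuffle K n 2 z w (fun j => n + n - j.+1)%N);
  last by move=> k b ltk; lia.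
rewrite !det_vand2 //.
have -> : \matrix_(i, j) ((w i - z j) / (w i ^+ 2 - z j ^+ 2)) =
    \matrix_(i, j) (w i + z j)^-1.
  by apply/matrixP => i j; rewrite !mxE subr_sqr; field; rewrite neB neD.
have -> : \matrix_(i, j) ((w i - z j) / (w i ^+ 3 - z j ^+ 3)) =
    (\matrix_(i, j) (z i ^+ 2 + z i * w j + w j ^+ 2)^-1)^T.
  apply/matrixP => i j; rewrite !mxE.
  have -> : w i ^+ 3 - z j ^+ 3 = (w i - z j) * (w i ^+ 2 + w i * z j + z j ^+ 2) by ring.
  rewrite invfM mulVKf //; congr (_^-1); ring.
rewrite det_tr.
have -> : \prod_(i < n) \prod_(j < n) (w i ^+ 3 - z j ^+ 3) =
    (\prod_(i < n) \prod_(j < n) (w i - z j)) *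
    \prod_(i < n) \prod_(j < n) (z i ^+ 2 + z i * w j + w j ^+ 2).
  rewrite [X in _ = _ * X]exchange_big -prod2M.
  by apply: eq_bigr => i _; apply: eq_bigr => j _; ring.
have -> : \prod_(i < n) \prod_(j < n) (w i ^+ 2 - z j ^+ 2) =
    (\prod_(i < n) \prod_(j < n) (w i - z j)) *
    \prod_(i < n) \prod_(j < n) (w i + z j).
  by rewrite -prod2M; apply: eq_bigr => i _; apply: eq_bigr => j _; rewrite subr_sqr.
rewrite vand_ratio [\det (vand K n z) * _]mulrC -det_cauchy_add //.
have e0 := signr_eq0 K (n * (n - 1))./2.
have P0 : \prod_(i < n) \prod_(j < n) (w i - z j) != 0.
  by apply/prodf_neq0 => i _; apply/prodf_neq0 => j _.
have : \det (vand K n w) * \det (vand K n z) != 0.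
  by rewrite mulf_neq0 ?det_vand_neq0.
rewrite -det_cauchy_add // mulf_eq0 negb_or => /andP[D0 C0].
move: ((-1) ^+ _) (\prod_(i < n) _) (\prod_(i < n) _) (\prod_(i < n) _) (\det _) (\det _) e0 P0 D0 C0.
move=> e P D Q d C e0 Q0 D0 C0.
by field; rewrite e0 Q0 D0 C0.
Qed.

(** * Opposite nodes and products of two characters *)

Definition even_mx (K : fieldType) (n : nat) (X a : 'I_n -> K) : 'M[K]_n :=
  \matrix_(i, k) (X i ^+ k * a i ^+ odd k).

Definition odd_mx (K : fieldType) (n : nat) (X a : 'I_n -> K) : 'M[K]_n :=
  \matrix_(i, k) (X i ^+ k * a i ^+ ~~ odd k).

Lemma prod_signs (K : comRingType) (n : nat) :
  \prod_(k < n) (-1) ^+ k = (-1) ^+ (n * (n - 1))./2 :> K.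
Proof.
rewrite -(big_mkord xpredT (fun k => (-1) ^+ k : K)) -expr_sum.
by rewrite bin2_sum bin2 subn1.
Qed.

(* The column operation exchanges the columns of odd index of the two blocks, so
   that the first block consists of functions that are even under the common
   change of sign of [X] and [a], and the second one of odd functions. *)
Lemma det_vand2_opp (K : fieldType) (n : nat) (X a : 'I_n -> K) :
  \det (vand2 K n X (fun i => - X i) a (fun i => - a i)) * (-1) ^+ (n * (n - 1))./2 =
  (- 2) ^+ n * (\det (even_mx K n X a) * \det (odd_mx K n X a)).
Proof.
pose P : 'M[K]_n := diag_mx (\row_k (~~ odd k)%:R).
pose Q : 'M[K]_n := diag_mx (\row_k (odd k)%:R).
pose E := even_mx K n X a; pose O := odd_mx K n X a.
have detS : \det (block_mx P Q Q P) = (-1) ^+ (n * (n - 1))./2.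
  (* Subtracting the first block row from the second and adding the second block column to the first
     makes the matrix triangular. *)
  have : block_mx 1%:M 0 (- 1%:M) 1%:M *m block_mx P Q Q P *m block_mx 1%:M 0 1%:M 1%:M =
      block_mx (P + Q) Q 0 (P - Q).
    rewrite !mulmx_block !mulmx0 !mul0mx !mulmx1 !mulNmx !mul1mx !addr0 !add0r.
    by congr block_mx; apply/matrixP => i j; rewrite !mxE; ring.
  move/(congr1 determinant); rewrite !det_mulmx !det_lblock det_ublock !det1 !mulr1 !mul1r => ->.
  have -> : P + Q = 1%:M.
    by apply/matrixP => i j; rewrite !mxE -mulrnDl; case: odd; rewrite ?addr0 ?add0r.
  have -> : P - Q = diag_mx (\row_k (-1) ^+ k).
    apply/matrixP => i j; rewrite !mxE -mulrnBl -signr_odd.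
    by case: odd; rewrite ?subr0 ?sub0r.
  rewrite det1 mul1r det_diag -prod_signs.
  by apply: eq_bigr => k _; rewrite mxE.
rewrite -detS -det_mulmx.
(* The rows of [- X] repeat [E] and negate [O]; subtracting the rows of [X] leaves 0 and
   [- 2 *: O]. *)
have -> : vand2 K n X (fun i => - X i) a (fun i => - a i) *m block_mx P Q Q P =
    block_mx 1%:M 0 1%:M 1%:M *m block_mx E O 0 (- 2 *: O).
  rewrite /vand2 !mulmx_block !mul1mx !mul0mx !addr0.
  congr block_mx; apply/matrixP => i k;
    rewrite [LHS]mxE /P /Q !mul_mx_diag !mul_diag_mx !mxE;
    rewrite -?signr_odd ?[(- X i) ^+ k]exprNn -?[in (-1) ^+ k]signr_odd; case: (odd k) => /=; ring.
by rewrite det_mulmx det_lblock det_ublock !det1 !mul1r detZ mulrCA.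
Qed.

(** Listing columns by increasing degree reverses them in both determinants, so the sign cancels. *)
Lemma GLchar_rev (K : fieldType) (n : nat) (lambda : seq nat) (t : 'I_n -> K)
    (e : nat -> nat) :
  (forall j, (j < n)%N -> (nth 0 lambda j + (n - j.+1) = e (n - j.+1))%N) ->
  GLchar lambda t = \det (\matrix_(i < n, k < n) t i ^+ e k) / \det (vand K n t).
Proof.
move=> he; rewrite /GLchar; pose s : 'S_n := perm (@rev_ord_inj n).
have -> : \matrix_(i < n, j < n) t i ^+ (nth 0 lambda j + (n - j.+1)) =
    col_perm s (\matrix_(i < n, k < n) t i ^+ e k).
  by apply/matrixP => i j; rewrite !mxE permE he.
have -> : \matrix_(i < n, j < n) t i ^+ (n - j.+1) = col_perm s (vand K n t).
  by apply/matrixP => i j; rewrite !mxE permE.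
rewrite !col_permE !det_mulmx -mulf_div divff ?mulr1 //.
by rewrite det_perm signr_eq0.
Qed.

Lemma GLchar_pair (K : fieldType) (n : nat) (t : 'I_n -> K) : (0 < n)%N ->
  GLchar (delta2 n./2 (n./2%:Z - 1)) t
  * GLchar (delta2 ((n - 1)./2) ((n - 1)./2)) t =
  \det (\matrix_(i < n, k < n) t i ^+ (k + uphalf k))
  * \det (\matrix_(i < n, k < n) t i ^+ (k + k./2))
  / (\det (vand K n t) * \det (vand K n t)).
Proof.
move=> n0; rewrite delta2_pred delta2_double.
(* The parity of [n] decides which of the two characters has the exponents [k + uphalf k]. The
   longer index sequence is cut by one entry, and none is padded. *)
have [oddn|evenn] := boolP (odd n).
  rewrite (GLchar_rev _ _ _ _ (fun k => k + k./2)%N);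
    last by move=> j ltj; rewrite nth_mkseq; lia.
  rewrite (GLchar_rev _ _ _ _ (fun k => k + uphalf k)%N);
    last by move=> j ltj; rewrite nth_mkseq; lia.
  by rewrite mulf_div [X in X / _]mulrC.
rewrite (GLchar_rev _ _ _ _ (fun k => k + uphalf k)%N);
  last by move=> j ltj; rewrite nth_mkseq; lia.
rewrite (GLchar_rev _ _ _ _ (fun k => k + k./2)%N);
  last by move=> j ltj; rewrite nth_mkseq; lia.
by rewrite mulf_div.
Qed.

(** Okada's determinant at the nodes [z i ^+ 3] and their opposites. Its even columns are powers of
    [z i ^+ 2], its odd ones are [z i] times such powers, with the exponents of [GLchar_pair]. *)
Lemma GLchar_pair_quad (K : fieldType) (n : nat) (z : 'I_n -> K) :
  (0 < n)%N ->
  injective (fun i => z i ^+ 2) -> injective (fun i => z i ^+ 3) ->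
  (forall i j, z i ^+ 3 + z j ^+ 3 != 0) ->
  (\prod_(i < n) \prod_(j < n) (z i ^+ 2 - z i * z j + z j ^+ 2))
  * \det (\matrix_(i < n, j < n) (z i ^+ 2 - z i * z j + z j ^+ 2)^-1)
  / (\prod_(i < n) \prod_(j < n | (i < j)%N) ((z j - z i) * (z j - z i))) =
  GLchar (delta2 n./2 (n./2%:Z - 1)) (fun i => z i ^+ 2)
  * GLchar (delta2 ((n - 1)./2) ((n - 1)./2)) (fun i => z i ^+ 2).
Proof.
move=> n0 inj2 inj3 neS.
have cubeE i j : z i ^+ 3 + z j ^+ 3 =
    (z i + z j) * (z i ^+ 2 - z i * z j + z j ^+ 2) by ring.
have neD i j : z i + z j != 0.
  by have := neS i j; rewrite cubeE mulf_eq0 negb_or => /andP[].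
(* A diagonal case of [neS]: in characteristic 2 the sum of two equal cubes vanishes. *)
have two0 : 2 != 0 :> K.
  apply: contraNneq (neS (Ordinal n0) (Ordinal n0)) => two0.
  by rewrite -mulr2n -mulr_natl two0 mul0r.
have z0 i : z i != 0.
  by apply: contraNneq (neD i i) => ->; rewrite addr0.
rewrite GLchar_pair // vand_ratio.
pose S := \prod_(i < n) \prod_(j < n | (i < j)%N) (z i + z j).
have vandE : \det (vand K n (fun i => z i ^+ 2)) = S * \det (vand K n z).
  rewrite !det_vand -big_split; apply: eq_bigr => i _.
  by rewrite -big_split; apply: eq_bigr => j _ /=; ring.
have evenE : even_mx K n (fun i => z i ^+ 3) z =
    \matrix_(i < n, k < n) (z i ^+ 2) ^+ (k + uphalf k).
  apply/matrixP => i k; rewrite !mxE -!exprM -exprD; congr (_ ^+ _); lia.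
have oddE : odd_mx K n (fun i => z i ^+ 3) z =
    diag_mx (\row_i z i) *m \matrix_(i < n, k < n) (z i ^+ 2) ^+ (k + k./2).
  apply/matrixP => i k; rewrite mul_diag_mx !mxE -!exprM -exprD -exprS.
  congr (_ ^+ _); lia.
have := det_vand2_opp K n (fun i => z i ^+ 3) z.
rewrite evenE oddE det_mulmx det_diag (eq_bigr z) => [|i _]; last by rewrite mxE.
rewrite det_vand2 // => [|i j]; last first.
  by rewrite -subr_eq0 -opprD oppr_eq0 addrC.
have -> : \matrix_(i, j) ((- z i - z j) / (- z i ^+ 3 - z j ^+ 3)) =
    \matrix_(i < n, j < n) (z i ^+ 2 - z i * z j + z j ^+ 2)^-1.
  apply/matrixP => i j; rewrite !mxE -!opprD invrN mulrNN cubeE invfM mulVKf //.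
have -> : \prod_(i < n) \prod_(j < n) (- z i ^+ 3 - z j ^+ 3) =
    (-1) ^+ n * (2 ^+ n * (\prod_i z i) * S ^+ 2) *
    \prod_(i < n) \prod_(j < n) (z i ^+ 2 - z i * z j + z j ^+ 2).
  (* The diagonal factors [z i + z i] give the power of 2 and the product of the [z i], the others
     give [S ^+ 2]. The first two then cancel against the even and odd splitting. *)
  have -> : (-1) ^+ n * (2 ^+ n * (\prod_i z i) * S ^+ 2) =
      \prod_(i < n) \prod_(j < n) (- 1 * (z i + z j)).
    rewrite prod2M (prod_split_diag _ _ (fun i j => z i + z j)) !prodr_const card_ord.
    rewrite -[in RHS]exprM -signr_odd -[in RHS]signr_odd oddM andbb; congr (_ * _).
    congr (_ * _).
      rewrite [RHS](eq_bigr (fun i => 2 * z i)) => [|i _]; last by ring.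
      by rewrite big_split prodr_const card_ord.
    rewrite /S -prodrXl; apply: eq_bigr => i _; rewrite -prodrXl.
    by apply: eq_bigr => j _; ring.
  rewrite -prod2M; apply: eq_bigr => i _; apply: eq_bigr => j _; ring.
have := det_vand_neq0 K n _ inj2; rewrite vandE mulf_eq0 negb_or => /andP[S0 V0].
have Z0 : \prod_i z i != 0 by apply/prodf_neq0 => i _.
have N0 : (-2) ^+ n != 0 :> K by rewrite expf_neq0 // oppr_eq0.
have -> : (-1) ^+ n * (2 ^+ n * (\prod_i z i) * S ^+ 2) = (-2) ^+ n * (\prod_i z i) * S ^+ 2 :> K.
  by rewrite [in RHS]exprNn !mulrA.
have ee : (-1) ^+ (n * (n - 1))./2 * (-1) ^+ (n * (n - 1))./2 = 1 :> K.
  by rewrite -expr2 sqrr_sign.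
set P := \prod_(i < n) \prod_(j < n) _; set D := \det _.
set A := \det (\matrix_(i, k) _); set B := \det (\matrix_(i, k) _) => h.
have -> : A * B = S ^+ 2 * (P * D).
  apply: (mulfI (mulf_neq0 N0 Z0)); rewrite -[LHS]mulrA [X in _ * X = _]mulrCA -h.
  by rewrite [_ * _ * D * _]mulrC !mulrA ee mul1r; ring.
by field; rewrite S0 V0.
Qed.

(** * Independence of the variables and values of the roots of unity *)

(** Treats [xvar] and [yvar] uniformly, as the cases of a left and of a right index. *)
Definition ratvar (R : realType) (n : nat) (k : 'I_(n + n)) : ratfun R n :=
  @FracField.tofrac (mpoly.mpoly (n + n) R[i]) (mpoly.mpolyX R[i] (mpoly.mnm1 k)).

(** Evaluation at the point whose only nonzero coordinate is a 1 at [k] would give 1 = 0. The sign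
    serves both for differences and for sums of powers. *)
Lemma ratvar_exp_neq (R : realType) (n : nat) (k l : 'I_(n + n)) (d : nat) (b : bool) :
  k != l -> (0 < d)%N -> ratvar R n k ^+ d != (-1) ^+ b * ratvar R n l ^+ d.
Proof.
move=> nekl d0; rewrite -(rmorph_sign (@FracField.tofrac (mpoly.mpoly (n + n) R[i]))).
rewrite -!rmorphXn -rmorphM -subr_eq0 -rmorphB tofrac_eq0 subr_eq0.
apply/eqP => /(congr1 (mpoly.meval (fun i => (i == k)%:R))).
rewrite rmorphM rmorph_sign !rmorphXn /= !mpoly.mevalXU eqxx expr1n eq_sym (negPf nekl).
by rewrite expr0n gtn_eqF // mulr0 => /eqP; rewrite oner_eq0.
Qed.

Lemma ratvar_neq0 (R : realType) (n : nat) (k : 'I_(n + n)) : ratvar R n k != 0.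
Proof.
rewrite tofrac_eq0; apply/eqP => /(congr1 (mpoly.meval (fun=> 1))).
by rewrite mpoly.mevalXU rmorph0 => /eqP; rewrite oner_eq0.
Qed.

Lemma ratvar_exp_inj (R : realType) (n d : nat) : (0 < d)%N ->
  injective (fun k => ratvar R n k ^+ d).
Proof.
move=> d0 k l e; apply/eqP; apply/negPn/negP => nekl.
by have := ratvar_exp_neq R n k l d false nekl d0; rewrite mul1r e eqxx.
Qed.

Lemma ratvar_addX_neq0 (R : realType) (n d : nat) (k l : 'I_(n + n)) :
  k != l -> (0 < d)%N -> ratvar R n k ^+ d + ratvar R n l ^+ d != 0.
Proof.
move=> nekl d0; rewrite addr_eq0 -mulN1r.
exact: ratvar_exp_neq R n k l d true nekl d0.
Qed.

Lemma ratfun_natr_neq0 (R : realType) (n m : nat) : (m.+1)%:R != 0 :> ratfun R n.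
Proof.
rewrite -(rmorph_nat (@FracField.tofrac (mpoly.mpoly (n + n) R[i]))) tofrac_eq0.
apply/eqP => /(congr1 (mpoly.meval (fun=> 0))).
by rewrite rmorph_nat rmorph0 => /eqP; rewrite Num.Theory.pnatr_eq0.
Qed.

Lemma ratC_exp (R : realType) (n d : nat) (c : R[i]) :
  ratC n (c ^+ d) = ratC n c ^+ d.
Proof. by rewrite /ratC !rmorphXn. Qed.

Lemma ratCN1 (R : realType) (n : nat) : ratC n (-1 : R[i]) = -1.
Proof. by rewrite /ratC !rmorphN1. Qed.

Lemma ratC_subr1 (R : realType) (n : nat) (c : R[i]) : ratC n (c - 1) = ratC n c - 1.
Proof. by rewrite /ratC !(rmorphB, rmorph1). Qed.

Lemma zeta_double (R : realType) (m : nat) :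
  (0 < m)%N -> zeta R (2 * m) ^+ 2 = zeta R m.
Proof.
move=> m0; rewrite /zeta; have m0' : m%:R != 0 :> R by rewrite Num.Theory.pnatr_eq0 -lt0n.
have -> : 2 * pi / m%:R = 2 * pi / (2 * m)%:R + 2 * pi / (2 * m)%:R :> R.
  by rewrite natrM; field; rewrite m0'.
by rewrite cosD sinD expr2; apply/eqP; rewrite eq_complex /=; apply/andP; split; apply/eqP; ring.
Qed.

Lemma zeta4_sqr (R : realType) : zeta R 4 ^+ 2 = -1.
Proof.
rewrite (zeta_double _ 2) // /zeta; have -> : 2 * pi / 2%:R = pi :> R by field.
by rewrite cospi sinpi; apply/eqP; rewrite eq_complex /= oppr0 !eqxx.
Qed.

(** A root of t^3 + 1 = (t + 1)(t^2 - t + 1) that differs from -1, since its imaginary part is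
    positive. *)
Lemma zeta6_sqr (R : realType) : zeta R 6 ^+ 2 = zeta R 6 - 1.
Proof.
have cube : zeta R 6 ^+ 3 = -1.
  have e : pi = 2 * pi / 6%:R + (2 * pi / 6%:R + 2 * pi / 6%:R) :> R by field.
  have := cospi R; have := sinpi R; rewrite {1 2}e !(cosD, sinD) => s c.
  apply/eqP; rewrite eq_complex /zeta !exprS expr0 /=.
  by apply/andP; split; apply/eqP; rewrite ?oppr0; [rewrite -[RHS]c|rewrite -[RHS]s]; ring.
have ne : zeta R 6 + 1 != 0.
  rewrite /zeta; apply/eqP => /(congr1 (@complex.Im R)) /= /eqP.
  rewrite addr0 Order.POrderTheory.gt_eqF // sin_gt0_pi //.
  by have := pi_gt0 R; lra.
apply/eqP; rewrite -subr_eq0; apply/eqP; apply: (mulfI ne); rewrite mulr0.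
have -> : (zeta R 6 + 1) * (zeta R 6 ^+ 2 - (zeta R 6 - 1)) = zeta R 6 ^+ 3 + 1 by ring.
by rewrite cube addNr.
Qed.

(** * The partition function at the four roots of unity *)

Lemma sigma_sqr (K : fieldType) (a : K) : a != 0 ->
  - sigma a ^+ 2 = 2 - (a ^+ 2 + a ^- 2).
Proof. by move=> a0; rewrite /sigma; field. Qed.

(** Only [c] matters: for the roots of unity of order 4, 6, 8 and 12 it is -2, -1, 0 and 1, so that
    the prefactor has base [2 - c] equal to 4, 3, 2 and 1. *)
Lemma Afun_quad_form (K : fieldType) (n : nat) (x y : 'I_n -> K) (a c : K)
    (q : K -> K -> K) :
  (0 < n)%N -> a != 0 -> (forall i, x i != 0) -> (forall i, y i != 0) ->
  a ^+ 2 + a ^- 2 = c -> (forall z w, q z w = z ^+ 2 + w ^+ 2 - c * z * w) ->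
  Afun x y a =
  (2 - c) ^- (n * (n - 1))./2
  * (\prod_(i < n) (x i ^ (- n%:Z + 1) * y i ^ (- n%:Z + 1)))
  * ((\prod_(i < n) \prod_(j < n) q (x i ^+ 2) (y j ^+ 2))
     * \det (\matrix_(i < n, j < n) (q (x i ^+ 2) (y j ^+ 2))^-1)
     / (\prod_(i < n) \prod_(j < n | (i < j)%N)
          ((x j ^+ 2 - x i ^+ 2) * (y j ^+ 2 - y i ^+ 2)))).
Proof.
move=> n0 a0 x0 y0 ac qE; rewrite Afun_quad // sigma_sqr // ac.
have e i j : quad a (x i) (y j) = q (x i ^+ 2) (y j ^+ 2).
  by rewrite /quad ac qE -!exprM.
congr (_ * (_ * _ / _)).
  by apply: eq_bigr => i _; apply: eq_bigr => j _; rewrite e.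
by congr determinant; apply/matrixP => i j; rewrite !mxE e.
Qed.

Lemma half_mul_pred (n : nat) : (2 * (n * (n - 1))./2 = n * (n - 1))%N.
Proof.
have := odd_double_half (n * (n - 1)); rewrite mul2n.
by case: n => // n; rewrite subn1 oddM /= andNb add0n.
Qed.

Section FourthRoots.
Variables (K : fieldType) (n : nat) (x y : 'I_n -> K) (a : K).
Hypotheses (n0 : (0 < n)%N) (x0 : forall i, x i != 0) (y0 : forall i, y i != 0).
Hypothesis injx : forall d, (0 < d)%N -> injective (fun i => x i ^+ d).
Hypothesis injy : forall d, (0 < d)%N -> injective (fun i => y i ^+ d).
Hypothesis neqyx : forall d i j, (0 < d)%N -> y i ^+ d != x j ^+ d.
Hypothesis addxy : forall d i j, (0 < d)%N -> x i ^+ d + y j ^+ d != 0.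
Hypothesis addxx : forall d i j, (0 < d)%N -> x i ^+ d + x j ^+ d != 0.

Let expX2 d (u : K) : (u ^+ 2) ^+ d = u ^+ (2 * d).
Proof. by rewrite exprM. Qed.

Let injX2 (u : 'I_n -> K) d :
  (forall d, (0 < d)%N -> injective (fun i => u i ^+ d)) -> (0 < d)%N ->
  injective (fun i => (u i ^+ 2) ^+ d).
Proof.
by move=> inju d0 i j; rewrite !expX2; apply: inju; rewrite muln_gt0.
Qed.

Lemma Afun_zeta4 : a ^+ 2 = -1 ->
  Afun x y a =
  2 ^ (- n%:Z ^+ 2 + n%:Z)
  * (\prod_(i < n) (x i ^ (- n%:Z + 1) * y i ^ (- n%:Z + 1)))
  * (\prod_(i < n) \prod_(j < n) (x i ^+ 2 + y j ^+ 2))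
  * permanent (\matrix_(i < n, j < n) (1 / (x i ^+ 2 + y j ^+ 2))).
Proof.
move=> a2.
have a0 : a != 0 by apply: contra_eq_neq a2 => ->; rewrite expr0n eq_sym oppr_eq0 oner_eq0.
rewrite (Afun_quad_form _ _ _ _ _ (-2) (fun z w => (z + w) ^+ 2)) //; first last.
- by move=> z w; ring.
- by rewrite a2 invrN1; ring.
rewrite borchardt_squares; [|exact: injx|exact: injy|by move=> i j; exact: addxy].
have -> : 2 ^ (- n%:Z ^+ 2 + n%:Z) = (2 - -2) ^- (n * (n - 1))./2 :> K.
  have -> : 2 - -2 = 2 ^+ 2 :> K by ring.
  rewrite -exprM half_mul_pred exprnN; congr (_ ^ _); rewrite mulnBr muln1 expr2; nia.
rewrite -!mulrA; congr (_ * (_ * (_ * permanent _))).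
by apply/matrixP => i j; rewrite !mxE div1r.
Qed.

Lemma Afun_zeta6 : a ^+ 2 = a - 1 ->
  Afun x y a =
  3 ^- (n * (n - 1))./2
  * (\prod_(i < n) (x i ^ (- n%:Z + 1) * y i ^ (- n%:Z + 1)))
  * GLchar (delta2 (n%:Z - 1) (n%:Z - 1))
      (catfun (fun i => x i ^+ 2) (fun j => y j ^+ 2)).
Proof.
move=> a2.
(* The inverse of [a ^+ 2] is thus [- a], which gives c = (a - 1) - a = -1. *)
have a3 : a ^+ 2 * - a = 1 by rewrite a2 mulrBl mul1r mulrN -expr2 a2; ring.
have a0 : a != 0 by apply: contra_eq_neq a3 => ->; rewrite oppr0 mulr0 eq_sym oner_eq0.
rewrite (Afun_quad_form _ _ _ _ _ (-1) (fun z w => z ^+ 2 + z * w + w ^+ 2)) //; first last.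
- by move=> z w; ring.
- by rewrite (mulr1_eq a3) a2; ring.
rewrite GLchar_double //; [|exact: injX2|exact: injX2|exact: injy| |].
- by congr (_ ^- _ * _ * _); ring.
- by move=> i j; rewrite !expX2 neqyx.
- by move=> i j; rewrite !expX2 neqyx.
Qed.

Lemma Afun_zeta8 : a ^+ 4 = -1 ->
  Afun x y a =
  2 ^- (n * (n - 1))./2
  * (\prod_(i < n) (x i ^ (- n%:Z + 1) * y i ^ (- n%:Z + 1)))
  * (\prod_(i < n) \prod_(j < n | (i < j)%N)
       ((x i ^+ 2 + x j ^+ 2) * (y i ^+ 2 + y j ^+ 2))).
Proof.
move=> a4; have a4' : a ^+ 2 * - a ^+ 2 = 1 by rewrite mulrN -exprD a4 opprK.
have a0 : a != 0.
  by apply: contra_eq_neq a4' => ->; rewrite expr0n mul0r eq_sym oner_eq0.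
rewrite (Afun_quad_form _ _ _ _ _ 0 (fun z w => z ^+ 2 + w ^+ 2)) //; first last.
- by move=> z w; ring.
- by rewrite (mulr1_eq a4') subrr.
rewrite cauchy_squares ?subr0 //; [exact: injX2|exact: injX2|].
by move=> i j; rewrite !expX2 addxy.
Qed.

Lemma Afun_zeta12 : a ^+ 4 = a ^+ 2 - 1 ->
  Afun x x a =
  (\prod_(i < n) x i ^ (- (2 * n%:Z) + 2))
  * GLchar (delta2 n./2 (n./2%:Z - 1)) (fun i => x i ^+ 4)
  * GLchar (delta2 ((n - 1)./2) ((n - 1)./2)) (fun i => x i ^+ 4).
Proof.
move=> a4; have a4' : a ^+ 2 * (1 - a ^+ 2) = 1.
  by rewrite mulrBr mulr1 -exprD a4; ring.
have a0 : a != 0.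
  by apply: contra_eq_neq a4' => ->; rewrite expr0n mul0r eq_sym oner_eq0.
rewrite (Afun_quad_form _ _ _ _ _ 1 (fun z w => z ^+ 2 - z * w + w ^+ 2)) //; first last.
- by move=> z w; ring.
- by rewrite (mulr1_eq a4'); ring.
rewrite GLchar_pair_quad //; [|exact: injX2|exact: injX2|]; last first.
  by move=> i j; rewrite !expX2 addxx.
have -> : (fun i => (x i ^+ 2) ^+ 2) = (fun i => x i ^+ 4).
  by apply: boolp.funext => i; rewrite expX2.
rewrite mulrA; congr (_ * _ * _).
have -> : 2 - 1 = 1 :> K by ring.
rewrite expr1n invr1 mul1r; apply: eq_bigr => i _.
rewrite -expfzDr //; congr (_ ^ _); lia.
Qed.
End FourthRoots.

Theorem theorem2p3 (R : realType) (n : nat) (hn : (1 <= n)%N) :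
  let x : 'I_n -> ratfun R n := @xvar R n in
  let y : 'I_n -> ratfun R n := @yvar R n in
  let p : nat := n./2 in
  let q : nat := (n - 1)./2 in
  [/\ Afun x y (ratC n (zeta R 4)) =
        2 ^ (- n%:Z ^+ 2 + n%:Z)
        * (\prod_(i < n) (x i ^ (- n%:Z + 1) * y i ^ (- n%:Z + 1)))
        * (\prod_(i < n) \prod_(j < n) (x i ^+ 2 + y j ^+ 2))
        * permanent (\matrix_(i < n, j < n) (1 / (x i ^+ 2 + y j ^+ 2))),
      Afun x y (ratC n (zeta R 6)) =
        3 ^- (n * (n - 1))./2
        * (\prod_(i < n) (x i ^ (- n%:Z + 1) * y i ^ (- n%:Z + 1)))
        * GLchar (delta2 (n%:Z - 1) (n%:Z - 1))
            (catfun (fun i => x i ^+ 2) (fun j => y j ^+ 2)),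
      Afun x y (ratC n (zeta R 8)) =
        2 ^- (n * (n - 1))./2
        * (\prod_(i < n) (x i ^ (- n%:Z + 1) * y i ^ (- n%:Z + 1)))
        * (\prod_(i < n) \prod_(j < n | (i < j)%N)
             ((x i ^+ 2 + x j ^+ 2) * (y i ^+ 2 + y j ^+ 2)))
    & Afun x x (ratC n (zeta R 12)) =
        (\prod_(i < n) x i ^ (- (2 * n%:Z) + 2))
        * GLchar (delta2 p%:Z (p%:Z - 1)) (fun i => x i ^+ 4)
        * GLchar (delta2 q%:Z q%:Z) (fun i => x i ^+ 4)].
Proof.
move=> x y p q.
have x0 i : x i != 0 := ratvar_neq0 R n (lshift n i).
have y0 i : y i != 0 := ratvar_neq0 R n (rshift n i).
have lr i j : lshift n i != rshift n j :> 'I_(n + n) by rewrite eq_lrshift.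
have injx d : (0 < d)%N -> injective (fun i => x i ^+ d).
  by move=> d0 i j /(ratvar_exp_inj R n d d0)/lshift_inj.
have injy d : (0 < d)%N -> injective (fun i => y i ^+ d).
  by move=> d0 i j /(ratvar_exp_inj R n d d0)/rshift_inj.
have neqyx d i j : (0 < d)%N -> y i ^+ d != x j ^+ d.
  by move=> d0; apply/eqP => /(ratvar_exp_inj R n d d0)/eqP; rewrite eq_rlshift.
have addxy d i j : (0 < d)%N -> x i ^+ d + y j ^+ d != 0.
  exact: ratvar_addX_neq0 (lr i j).
have addxx d i j : (0 < d)%N -> x i ^+ d + x j ^+ d != 0.
  (* With [y] replaced by [x] the diagonal sums are [2 * x i ^+ d], nonzero in characteristic 0. *)
  move=> d0; have [->|ne] := eqVneq i j.
    by rewrite -mulr2n -mulr_natl; apply: mulf_neq0;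
      [exact: ratfun_natr_neq0 | exact: expf_neq0].
  by apply: ratvar_addX_neq0 => //; rewrite (inj_eq (@lshift_inj n n)).
split.
- by apply: Afun_zeta4 => //; rewrite -ratC_exp zeta4_sqr ratCN1.
- by apply: Afun_zeta6 => //; rewrite -ratC_exp zeta6_sqr ratC_subr1.
- apply: Afun_zeta8 => //; rewrite -ratC_exp (exprM _ 2 2) (zeta_double _ 4) //.
  by rewrite zeta4_sqr ratCN1.
apply: Afun_zeta12 => //; rewrite -!ratC_exp (exprM _ 2 2) (zeta_double _ 6) //.
by rewrite zeta6_sqr ratC_subr1.
Qed.
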